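(* Let $\mathcal{T}$ be a symmetric real tensor of order $m$ and dimension $n$, and let $(\boldsymbol{x}^*,\lambda^* )$ be a real eigenpair of $\mathcal{T}$. Suppose that $(\boldsymbol{x}^*,\lambda^* )$ is $\gamma$-Newton-stable (for some $\gamma>0$) and that $\lambda^*\neq 0$. Then there exists an $\varepsilon=\varepsilon(\gamma,\lambda^* )>0$ such that for any $\boldsymbol{x}_{(0)}\in S_{n-1}$ that satisfies $\|\boldsymbol{x}_{(0)}-\boldsymbol{x}^*\|<\varepsilon$, the sequence $\boldsymbol{x}_{(0)},\boldsymbol{x}_{(1)},\dots$ of Newton correction method (NCM) iterates started at $\boldsymbol{x}_{(0)}$ converges to $\boldsymbol{x}^*$ at a quadratic rate.
   Context: $S_{n-1}=\{\boldsymbol{x}\in\mathbb{R}^n:\|\boldsymbol{x}\|=1\}$ is the Euclidean unit sphere and $I$ is the identity matrix. A tensor $\mathcal{T}\in\mathbb{R}^{n\times\cdots\times n}$ of order $m$ and dimension $n$ has entries $t_{i_1,\dots,i_m}$, $i_1,\dots,i_m\in\{1,\dots,n\}$; it is symmetric if its entries are invariant under all permutations of the $m$ indices. For $\boldsymbol{x}\in\mathbb{R}^n$: $\mu(\boldsymbol{x})=\mathcal{T}(\boldsymbol{x},\dots,\boldsymbol{x})=\sum_{i_1,\dots,i_m} t_{i_1,\dots,i_m}x_{i_1}\cdots x_{i_m}\in\mathbb{R}$; $\mathcal{T}(I,\boldsymbol{x},\dots,\boldsymbol{x})\in\mathbb{R}^n$ is the vector with $i$-th entry $\sum_{i_2,\dots,i_m}t_{i,i_2,\dots,i_m}x_{i_2}\cdots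 x_{i_m}$; $\mathcal{T}(I,I,\boldsymbol{x},\dots,\boldsymbol{x})\in\mathbb{R}^{n\times n}$ is the matrix with $(i,j)$ entry $\sum_{i_3,\dots,i_m}t_{i,j,i_3,\dots,i_m}x_{i_3}\cdots x_{i_m}$. A pair $(\boldsymbol{x}^*,\lambda^* )\in\mathbb{R}^n\times\mathbb{R}$ is a real eigenpair of $\mathcal{T}$ if $\mathcal{T}(I,\boldsymbol{x}^*,\dots,\boldsymbol{x}^* )=\lambda^*\boldsymbol{x}^*$ and $\|\boldsymbol{x}^*\|=1$. Define $\boldsymbol{g}(\boldsymbol{x})=\mathcal{T}(I,\boldsymbol{x},\dots,\boldsymbol{x})-\mu(\boldsymbol{x})\boldsymbol{x}$, $H(\boldsymbol{x})=(m-1)\mathcal{T}(I,I,\boldsymbol{x},\dots,\boldsymbol{x})-\mu(\boldsymbol{x})I$, and $A(\boldsymbol{x})=H(\boldsymbol{x})-m\,\boldsymbol{x}\,\mathcal{T}(I,\boldsymbol{x},\dots,\boldsymbol{x})^T$. For $\boldsymbol{x}\in S_{n-1}$ let $U_{\boldsymbol{x}}\in\mathbb{R}^{n\times(n-1)}$ have orthonormal columns spanning the orthogonal complement of $\boldsymbol{x}$, and let $H_p(\boldsymbol{x})=U_{\boldsymbol{x}}^TH(\boldsymbol{x})U_{\boldsymbol{x}}$ (projected Hessian). For $\gamma>0$, an eigenpair $(\boldsymbol{x}^*,\lambda^* )$ is $\gamma$-Newton-stable if all eigenvalues of $H_p(\boldsymbol{x}^* )$ have absolute value at least $\gamma$.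 NCM: starting from $\boldsymbol{x}_{(0)}\in S_{n-1}$, iterate for $k=0,1,2,\dots$: $\boldsymbol{y}_{(k)}=-A(\boldsymbol{x}_{(k)})^{-1}\boldsymbol{g}(\boldsymbol{x}_{(k)})$ and $\boldsymbol{x}_{(k+1)}=(\boldsymbol{x}_{(k)}+\boldsymbol{y}_{(k)})/\|\boldsymbol{x}_{(k)}+\boldsymbol{y}_{(k)}\|$ (the stopping criterion is ignored, so the sequence is infinite; the claim includes that the iterates are well defined). Convergence to $\boldsymbol{x}^*$ at a quadratic rate means $\boldsymbol{x}_{(k)}\to\boldsymbol{x}^*$ and there is a constant $C>0$ such that $\|\boldsymbol{x}^*-\boldsymbol{x}_{(k+1)}\|\le C\|\boldsymbol{x}^*-\boldsymbol{x}_{(k)}\|^2$ for all $k\ge 0$. *)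

(* Defs.v *)
From HB Require Import structures.
From mathcomp Require Import all_boot all_order all_algebra all_fingroup.
From mathcomp Require Import all_classical all_reals all_analysis.
Import Order.TTheory GRing.Theory Num.Theory numFieldNormedType.Exports.
Set Implicit Arguments.
Unset Strict Implicit.
Unset Printing Implicit Defensive.
Local Open Scope classical_set_scope.
Local Open Scope ring_scope.

(* The library norm on matrices is the sup norm, hence a separate Euclidean
   norm; the two induce the same topology on 'cV[R]_n. *)
Definition norm2 (R : realType) (n : nat) (x : 'cV[R]_n) : R :=
  Num.sqrt (\sum_(i < n) x i 0 ^+ 2).

Definition sphere (R : realType) (n : nat) : set 'cV[R]_n :=
  [set x | norm2 x = 1].

Definition tensor (R : realType) (m n : nat) : Type := m.-tuple 'I_n -> R.

Definition symmetric_tensor (R : realType) (m n : nat) (T : tensor R m n) :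
    Prop :=
  forall (s : 'S_m) (t : m.-tuple 'I_n), T [tuple tnth t (s k) | k < m] = T t.

(* The order-m tensor obtained by fixing the first index to i. *)
Definition slice (R : realType) (m n : nat) (T : tensor R m.+1 n) (i : 'I_n) :
    tensor R m n :=
  fun t => T [tuple of i :: t].

Definition mu (R : realType) (m n : nat) (T : tensor R m n) (x : 'cV[R]_n) : R :=
  \sum_(t : m.-tuple 'I_n) T t * \prod_(k < m) x (tnth t k) 0.

(* T(I, x, ..., x) *)
Definition contractI (R : realType) (m n : nat) (T : tensor R m.+1 n)
    (x : 'cV[R]_n) : 'cV[R]_n :=
  \col_i mu (slice T i) x.

(* T(I, I, x, ..., x) *)
Definition contractII (R : realType) (m n : nat) (T : tensor R m.+2 n)
    (x : 'cV[R]_n) : 'M[R]_n :=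
  \matrix_(i, j) mu (slice (slice T i) j) x.

Definition eigenpair (R : realType) (m n : nat) (T : tensor R m.+1 n)
    (x : 'cV[R]_n) (lambda : R) : Prop :=
  contractI T x = lambda *: x /\ norm2 x = 1.

Definition gvec (R : realType) (m n : nat) (T : tensor R m.+1 n)
    (x : 'cV[R]_n) : 'cV[R]_n :=
  contractI T x - mu T x *: x.

(* T(I, I, x, ..., x) only makes sense for order at least 2, so here and below
   the order is written m.+2: the factor "order - 1" of the matrix H is m.+1,
   and the factor "order" of the matrix A is m.+2. *)
Definition Hmat (R : realType) (m n : nat) (T : tensor R m.+2 n)
    (x : 'cV[R]_n) : 'M[R]_n :=
  m.+1%:R *: contractII T x - (mu T x)%:M.

Definition Amat (R : realType) (m n : nat) (T : tensor R m.+2 n)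
    (x : 'cV[R]_n) : 'M[R]_n :=
  Hmat T x - m.+2%:R *: (x *m (contractI T x)^T).

(* The columns of U are orthonormal and span the orthogonal complement of x;
   kermx x is the space of the row vectors v with v *m x = 0. *)
Definition orthonormal_complement (R : realType) (n : nat) (x : 'cV[R]_n)
    (U : 'M[R]_(n, n.-1)) : Prop :=
  U^T *m U = 1%:M /\ (U^T == kermx x)%MS.

Definition Hproj (R : realType) (m n : nat) (T : tensor R m.+2 n)
    (x : 'cV[R]_n) (U : 'M[R]_(n, n.-1)) : 'M[R]_n.-1 :=
  U^T *m Hmat T x *m U.

(* Two admissible choices of U give orthogonally similar projected Hessians, so
   the condition does not depend on U. The projected Hessian of a symmetric
   tensor is symmetric, so its eigenvalues all lie in R. *)
Definition newton_stable (R : realType) (m n : nat) (T : tensor R m.+2 n)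
    (gamma : R) (x : 'cV[R]_n) : Prop :=
  exists2 U : 'M[R]_(n, n.-1), orthonormal_complement x U &
    forall a : R, eigenvalue (Hproj T x U) a -> gamma <= `|a|.

Definition ncm_correction (R : realType) (m n : nat) (T : tensor R m.+2 n)
    (x : 'cV[R]_n) : 'cV[R]_n :=
  - (invmx (Amat T x) *m gvec T x).

Definition ncm_step (R : realType) (m n : nat) (T : tensor R m.+2 n)
    (x : 'cV[R]_n) : 'cV[R]_n :=
  (norm2 (x + ncm_correction T x))^-1 *: (x + ncm_correction T x).

Definition ncm (R : realType) (m n : nat) (T : tensor R m.+2 n)
    (x0 : 'cV[R]_n) (k : nat) : 'cV[R]_n :=
  iter k (ncm_step T) x0.

(* invmx and ^-1 are total, so well-definedness of the iteration is a separate
   condition. *)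
Definition ncm_well_defined (R : realType) (m n : nat) (T : tensor R m.+2 n)
    (x0 : 'cV[R]_n) : Prop :=
  forall k : nat, Amat T (ncm T x0 k) \in unitmx /\
    ncm T x0 k + ncm_correction T (ncm T x0 k) != 0.

Definition converges_quadratically (R : realType) (n : nat)
    (x : nat -> 'cV[R]_n) (xs : 'cV[R]_n) : Prop :=
  x @ \oo --> xs /\
  exists2 C : R, 0 < C &
    forall k : nat, norm2 (xs - x k.+1) <= C * norm2 (xs - x k) ^+ 2.

(* Main.v *)
Require Import Defs.
From mathcomp Require Import all_boot all_order all_algebra all_fingroup.
From mathcomp Require Import all_classical all_reals all_analysis.
From mathcomp Require Import ring lra.
Import Order.TTheory GRing.Theory Num.Theory numFieldNormedType.Exports.
Set Implicit Arguments.
Unset Strict Implicit.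
Unset Printing Implicit Defensive.
Local Open Scope classical_set_scope.
Local Open Scope ring_scope.

(** The correction step is Newton's method for the map [gvec T]: by symmetry of
    T, the gradient of x |-> T(x, ..., x) is the order of T times T(I, x, ..., x),
    and the product rule then shows that [Amat T x] is exactly the Jacobian of
    [gvec T] at x. An eigenpair is a zero of [gvec T], so quadratic convergence
    follows once the Jacobian is invertible near the eigenvector; the final
    normalization at most doubles the distance to a unit vector.

    The point needing care is that the radius eps must not depend on the
    eigenvector xs, only on T, gamma and lambda. Two kinds of uniformity give
    this.
    - At an eigenpair, [Amat T xs] is symmetric, maps xs to -2 lambda xs, and
      acts on the orthogonal complement of xs as the projected Hessian. Its
      eigenvalues therefore have absolute value at least
      d = min(gamma, 2 |lambda|), and since it is symmetric it satisfies
      d |v| <= |Amat T xs v| for all v ([Amat_eigenpair_bound]). That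
      consequence of the spectral theorem is obtained in
      [symmetric_eigenvalue_bound] by minimizing |S w| on the unit sphere.
    - The quadratic Taylor remainder of [gvec T] ([newton_remainder]) and the
      Lipschitz constant of [Amat T] ([Amat_lipschitz]) are bounded on the whole
      unit ball, because the entries are polynomials. The class of functions
      with such bounds, [has_taylor], is closed under sums and products.

    [ncm_step_quadratic] combines the two: within distance eps the lower bound
    d / 2 persists for [Amat T x], and one step sends the distance r to at most
    C r^2, with C eps <= 1/2. Hence the distance is halved at every step, the
    iterates never leave the neighbourhood, and the quadratic bound holds along
    the whole sequence. *)

(** * Euclidean inner product and norm *)

Definition dot (R : realType) (n : nat) (x y : 'cV[R]_n) : R := (x^T *m y) 0 0.

Lemma dotE (R : realType) n (x y : 'cV[R]_n) :
  dot x y = \sum_i x i 0 * y i 0.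
Proof. by rewrite /dot mxE; apply: eq_bigr => i _; rewrite mxE. Qed.

Lemma dotC (R : realType) n (x y : 'cV[R]_n) : dot x y = dot y x.
Proof. by rewrite !dotE; apply: eq_bigr => i _; rewrite mulrC. Qed.

Lemma dotDr (R : realType) n (x y z : 'cV[R]_n) :
  dot x (y + z) = dot x y + dot x z.
Proof. by rewrite /dot mulmxDr mxE. Qed.

Lemma dotZr (R : realType) n a (x y : 'cV[R]_n) :
  dot x (a *: y) = a * dot x y.
Proof. by rewrite /dot -scalemxAr mxE. Qed.

Lemma dotDl (R : realType) n (x y z : 'cV[R]_n) :
  dot (y + z) x = dot y x + dot z x.
Proof. by rewrite dotC dotDr !(dotC x). Qed.

Lemma dotZl (R : realType) n a (x y : 'cV[R]_n) :
  dot (a *: y) x = a * dot y x.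
Proof. by rewrite dotC dotZr dotC. Qed.

Lemma dot_adjoint (R : realType) m n (A : 'M[R]_(m, n)) x y :
  dot x (A *m y) = dot (A^T *m x) y.
Proof. by rewrite /dot trmx_mul trmxK mulmxA. Qed.

Lemma dot_ge0 (R : realType) n (x : 'cV[R]_n) : 0 <= dot x x.
Proof. by rewrite dotE; apply: sumr_ge0 => i _; rewrite -expr2 sqr_ge0. Qed.

Lemma dot_eq0 (R : realType) n (x : 'cV[R]_n) : dot x x = 0 -> x = 0.
Proof.
rewrite dotE => /psumr_eq0P x0; apply/colP => i; rewrite mxE; apply/eqP.
by rewrite -sqrf_eq0 expr2 x0// => j _; rewrite -expr2 sqr_ge0.
Qed.

Lemma norm2E (R : realType) n (x : 'cV[R]_n) : norm2 x = Num.sqrt (dot x x).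
Proof.
by rewrite /norm2 dotE; congr Num.sqrt; apply: eq_bigr => i _; rewrite expr2.
Qed.

Lemma norm2_ge0 (R : realType) n (x : 'cV[R]_n) : 0 <= norm2 x.
Proof. exact: sqrtr_ge0. Qed.

Lemma norm2_sqr (R : realType) n (x : 'cV[R]_n) : norm2 x ^+ 2 = dot x x.
Proof. by rewrite norm2E sqr_sqrtr// dot_ge0. Qed.

Lemma norm2_eq0 (R : realType) n (x : 'cV[R]_n) : norm2 x = 0 -> x = 0.
Proof. by move=> x0; apply: dot_eq0; rewrite -norm2_sqr x0 expr0n. Qed.

Lemma norm2Z (R : realType) n a (x : 'cV[R]_n) :
  norm2 (a *: x) = `|a| * norm2 x.
Proof.
by rewrite !norm2E dotZl dotZr mulrA -expr2 sqrtrM ?sqr_ge0// sqrtr_sqr.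
Qed.

Lemma norm2N (R : realType) n (x : 'cV[R]_n) : norm2 (- x) = norm2 x.
Proof. by rewrite -scaleN1r norm2Z normrN1 mul1r. Qed.

Lemma norm20 (R : realType) n : norm2 (0 : 'cV[R]_n) = 0.
Proof. by rewrite -(scale0r 0) norm2Z normr0 mul0r. Qed.

Lemma norm2_distC (R : realType) n (x y : 'cV[R]_n) :
  norm2 (x - y) = norm2 (y - x).
Proof. by rewrite -norm2N opprB. Qed.

(** The inequality is the nonnegativity of the squared length of
    <y,y> x - <x,y> y, which equals <y,y> (<x,x> <y,y> - <x,y>^2). *)
Lemma Cauchy_Schwarz_dot (R : realType) n (x y : 'cV[R]_n) :
  dot x y ^+ 2 <= dot x x * dot y y.
Proof.
have [y0|y_neq0] := eqVneq (dot y y) 0.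
  by rewrite (dot_eq0 y0) -(scale0r 0) !dotZr !mul0r mulr0 expr0n.
have y_gt0 : 0 < dot y y by rewrite lt_def y_neq0 dot_ge0.
have := dot_ge0 (dot y y *: x + (- dot x y) *: y).
rewrite !(dotDl, dotDr, dotZl, dotZr) (dotC y x).
rewrite [leRHS](_ : _ = dot y y * (dot x x * dot y y - dot x y ^+ 2)); last by ring.
by rewrite pmulr_rge0// subr_ge0.
Qed.

Lemma dot_norm2 (R : realType) n (x y : 'cV[R]_n) :
  `|dot x y| <= norm2 x * norm2 y.
Proof.
rewrite -(ler_pXn2r (n := 2))// ?nnegrE ?mulr_ge0 ?norm2_ge0//.
by rewrite real_normK ?num_real// exprMn !norm2_sqr Cauchy_Schwarz_dot.
Qed.

Lemma norm2D (R : realType) n (x y : 'cV[R]_n) :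
  norm2 (x + y) <= norm2 x + norm2 y.
Proof.
rewrite -(ler_pXn2r (n := 2))// ?nnegrE ?addr_ge0 ?norm2_ge0//.
rewrite norm2_sqr !(dotDl, dotDr) (dotC y x) sqrrD -!norm2_sqr.
have := le_trans (ler_norm _) (dot_norm2 x y); lra.
Qed.

Lemma norm2B (R : realType) n (x y : 'cV[R]_n) :
  norm2 x - norm2 y <= norm2 (x - y).
Proof. by rewrite lerBlDr; apply: le_trans (norm2D _ _); rewrite subrK. Qed.

Lemma coord_norm2 (R : realType) n (x : 'cV[R]_n) i : `|x i 0| <= norm2 x.
Proof.
rewrite -sqrtr_sqr /norm2 ler_sqrt ?sumr_ge0// => [|j _]; last exact: sqr_ge0.
by rewrite (bigD1 i)//= lerDl sumr_ge0// => j _; exact: sqr_ge0.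
Qed.

(** The factor n instead of sqrt n is crude, but only the existence of a
    constant matters for the estimates built on it. *)
Lemma norm2_bound (R : realType) n (x : 'cV[R]_n) (b : R) :
  (forall i, `|x i 0| <= b) -> norm2 x <= n%:R * b.
Proof.
case: n x => [|n] x xb.
  by rewrite (_ : x = 0) ?norm20 ?mul0r//; apply/colP => -[].
have b0 : 0 <= b by apply: le_trans (xb 0).
have nb0 : 0 <= n.+1%:R * b by rewrite mulr_ge0.
rewrite -(ger0_norm nb0) -sqrtr_sqr /norm2 ler_sqrt ?sqr_ge0//.
rewrite (@le_trans _ _ (\sum_(i < n.+1) b ^+ 2))//.
  apply: ler_sum => i _; rewrite -(real_normK (num_real (x i 0))).
  by rewrite ler_pXn2r// nnegrE.
rewrite sumr_const card_ord exprMn -[leLHS]mulr_natl ler_wpM2r ?sqr_ge0//.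
by rewrite -natrX ler_nat expnS leq_pmulr.
Qed.

Lemma mulmx_norm2_bound (R : realType) n (B : 'M[R]_n) (v : 'cV[R]_n) (b : R) :
  (forall i j, `|B i j| <= b) -> norm2 (B *m v) <= n%:R * n%:R * b * norm2 v.
Proof.
move=> Bb; rewrite -!mulrA; apply: norm2_bound => i.
rewrite mxE (le_trans (ler_norm_sum _ _ _))//.
rewrite (@le_trans _ _ (\sum_(j < n) b * norm2 v))//.
  by apply: ler_sum => j _; rewrite normrM ler_pM ?coord_norm2.
by rewrite sumr_const card_ord -[leLHS]mulr_natl.
Qed.

(** Convergence in 'cV[R]_n refers to the sup norm; this transfers Euclidean
    estimates to it. *)
Lemma mx_norm_le_norm2 (R : realType) n (x : 'cV[R]_n) : `|x| <= norm2 x.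
Proof.
rewrite [leLHS]/Num.norm /= mx_normrE; apply/bigmax_leP; split=> [|[i j] _ /=].
  exact: norm2_ge0.
by rewrite ord1 coord_norm2.
Qed.

(** * Symmetric matrices whose eigenvalues avoid a neighbourhood of 0 *)

(** A vector where the form w |-> <w, B w> vanishes minimizes it, so its gradient
    2 B u is zero there. Moving from u by a small negative multiple of B u would
    otherwise make the form negative. *)
Lemma psd_kernel (R : realType) n (B : 'M[R]_n) (u : 'cV[R]_n) :
  B^T = B -> (forall w, 0 <= dot w (B *m w)) -> dot u (B *m u) = 0 ->
  B *m u = 0.
Proof.
move=> symB psdB uBu; set w := B *m u; set K := dot w (B *m w).
have K0 : 0 <= K := psdB w.
have K1 : 0 < K + 1 by lra.
apply: dot_eq0; set W := dot w w.
(* Any small enough step proportional to W would do; adding 1 to K keeps the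
   denominator positive even when K = 0. *)
pose t := - (W / (K + 1)).
have := psdB (u + t *: w).
rewrite mulmxDr -scalemxAr !(dotDl, dotDr, dotZl, dotZr) uBu -/w -/K.
rewrite dot_adjoint symB -/w -/W.
rewrite [leRHS](_ : _ = - (W / (K + 1)) ^+ 2 * (K + 2)); last first.
  by rewrite /t; field; rewrite gt_eqF.
rewrite mulNr oppr_ge0 pmulr_lle0; last by lra.
move=> h; apply/eqP; have : (W / (K + 1)) ^+ 2 == 0.
  by rewrite eq_le h sqr_ge0.
by rewrite sqrf_eq0 mulf_eq0 invr_eq0 (gt_eqF K1) orbF.
Qed.

(** Compactness of the unit sphere gives the minimizer; homogeneity turns the
    minimum over the sphere into a lower bound for all w. *)
Lemma quadratic_min (R : realType) n (S : 'M[R]_n) (v : 'cV[R]_n) : v != 0 ->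
  exists2 u : 'cV[R]_n, norm2 u = 1 &
    forall w, norm2 (S *m u) * norm2 w <= norm2 (S *m w).
Proof.
move=> v0.
have cdot m (A : 'M[R]_(m, n)) :
    continuous (fun w : 'rV[R]_n => dot (A *m w^T) (A *m w^T)).
  rewrite (_ : (fun w => _) =
      (fun w : 'rV[R]_n =>
         \sum_i (\sum_j A i j * w 0 j) * (\sum_j A i j * w 0 j))); last first.
    apply/funext => z; rewrite dotE; apply: eq_bigr => i _.
    by congr (_ * _); rewrite mxE; apply: eq_bigr => j _; rewrite mxE.
  have crow i : continuous (fun w : 'rV[R]_n => \sum_j A i j * w 0 j).
    apply: continuous_big => [|j _]; first exact: add_continuous.
    by move=> w; apply: continuousM; [exact: cst_continuous|exact: coord_continuous].
  apply: continuous_big => [|i _]; first exact: add_continuous.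
  by move=> w; apply: continuousM; exact: crow.
pose E := [set w : 'rV[R]_n | dot w^T w^T = 1].
(* The sphere is a level set of the continuous map above with A = 1. *)
have EE : E = (fun w : 'rV[R]_n => dot (1%:M *m w^T) (1%:M *m w^T)) @^-1` [set 1].
  by apply/seteqP; split=> w; rewrite /E /= mul1mx.
have cE : compact E.
  apply: bounded_closed_compact.
    exists 1; split=> // M M1 w /= Ew; apply: le_trans (ltW M1).
    rewrite [leLHS]/Num.norm /= mx_normrE; apply/bigmax_leP; split=> // -[i j] _ /=.
    rewrite ord1 (_ : w 0 j = w^T j 0); last by rewrite mxE.
    rewrite (le_trans (coord_norm2 w^T j))//.
    by rewrite norm2E Ew sqrtr1.
  by rewrite EE; apply: preimage_closed => [w _|]; [exact: cdot|exact: closed_eq].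
have nv : norm2 v != 0 by apply: contra_neq v0; exact: norm2_eq0.
have normalized w : norm2 w != 0 -> E ((norm2 w)^-1 *: w)^T.
  move=> nw; rewrite /E /= trmxK dotZl dotZr -norm2_sqr expr2 mulKf//.
  by rewrite mulVf.
have E0 : E !=set0 by exists ((norm2 v)^-1 *: v)^T; exact: normalized.
have [u Eu minu] := compact_EVT_min E0 cE (continuous_subspaceT (cdot _ S)).
exists u^T; first by rewrite norm2E; move: Eu; rewrite inE => ->; rewrite sqrtr1.
move=> w; have [w0|nw] := eqVneq (norm2 w) 0.
  by rewrite w0 mulr0 norm2_ge0.
have nw_gt0 : 0 < norm2 w by rewrite lt_def nw norm2_ge0.
have := minu ((norm2 w)^-1 *: w)^T; rewrite inE => /(_ (normalized _ nw)).
rewrite trmxK -!norm2_sqr -scalemxAr norm2Z ger0_norm ?invr_ge0 ?norm2_ge0//.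
rewrite ler_pXn2r ?nnegrE ?mulr_ge0 ?invr_ge0 ?norm2_ge0//.
by rewrite mulrC ler_pdivlMr.
Qed.

(** At a minimizer u of |S w| on the sphere, with minimum c, the matrix
    S^2 - c^2 is positive semidefinite and its form vanishes at u, so
    (S - c)(S + c) u = 0. Hence c or -c is an eigenvalue of S, which bounds c,
    and with it |S v| / |v|, from below. *)
Lemma symmetric_eigenvalue_bound (R : realType) n (S : 'M[R]_n) (g : R) :
  S^T = S -> (forall a, eigenvalue S a -> g <= `|a|) ->
  forall v, g * norm2 v <= norm2 (S *m v).
Proof.
move=> symS eigS v; have [->|v0] := eqVneq v 0.
  by rewrite norm20 mulr0 norm2_ge0.
have [u u1 minu] := quadratic_min S v0.
set c := norm2 (S *m u) in minu.
have eig_col a (w : 'cV_n) : S *m w = a *: w -> w != 0 -> eigenvalue S a.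
  move=> Sw w0; apply/eigenvalueP; exists w^T; last by rewrite trmx_eq0.
  by rewrite -{1}symS -trmx_mul Sw linearZ.
have c0 : 0 <= c := norm2_ge0 _.
have u0 : u != 0 by apply: contra_eq_neq u1 => ->; rewrite norm20 eq_sym oner_neq0.
suff gc : g <= c by apply: le_trans (minu v); rewrite ler_wpM2r ?norm2_ge0.
have Bw w : dot w ((S *m S - (c ^+ 2)%:M) *m w) =
    norm2 (S *m w) ^+ 2 - (c * norm2 w) ^+ 2.
  rewrite mulmxBl mul_scalar_mx -mulmxA -scaleNr dotDr dotZr dot_adjoint symS.
  by rewrite exprMn !norm2_sqr mulNr.
have Bu : (S *m S - (c ^+ 2)%:M) *m u = 0.
  apply: psd_kernel => [|w|].
  - by rewrite linearB/= trmx_mul symS tr_scalar_mx.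
  - by rewrite Bw subr_ge0 ler_pXn2r ?nnegrE ?mulr_ge0 ?norm2_ge0.
  - by rewrite Bw u1 mulr1 subrr.
have SSu : S *m (S *m u) = c ^+ 2 *: u.
  by apply/eqP; rewrite -subr_eq0 -mul_scalar_mx mulmxA -mulmxBl Bu.
(* Either u itself or (S + c) u is an eigenvector. *)
have [w0|w0] := eqVneq (S *m u + c *: u) 0.
  rewrite -(ger0_norm c0) -normrN; apply: eigS; apply: eig_col u0.
  by apply/eqP; rewrite scaleNr -addr_eq0 w0.
rewrite -(ger0_norm c0); apply: eigS; apply: eig_col w0.
by rewrite mulmxDr SSu -scalemxAr scalerDr scalerA -expr2 addrC.
Qed.

(** * Slices of a tensor *)

Lemma mu_slice (R : realType) m n (T : tensor R m.+1 n) (x : 'cV[R]_n) :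
  mu T x = \sum_i x i 0 * mu (slice T i) x.
Proof.
rewrite /mu; under [RHS]eq_bigr do rewrite big_distrr/=.
rewrite pair_big/=.
rewrite (reindex (fun p : 'I_n * m.-tuple 'I_n => [tuple of p.1 :: p.2]))/=.
  apply: eq_bigr => -[i t] _ /=; rewrite /slice big_ord_recl mulrCA; congr (_ * _).
  by congr (_ * _); apply: eq_bigr => k _; rewrite tnthS.
exists (fun t : m.+1.-tuple 'I_n => (thead t, [tuple of behead t])) => [[i t]|t] _ /=.
  by congr (_, _); apply: val_inj.
by rewrite -tuple_eta.
Qed.

Lemma slice_symmetric (R : realType) m n (T : tensor R m.+1 n) i :
  symmetric_tensor T -> symmetric_tensor (slice T i).
Proof.
move=> symT s t; rewrite /slice -[RHS](symT (lift_perm ord0 ord0 s)).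
congr T; apply: eq_from_tnth => k; rewrite tnth_mktuple.
case: (unliftP ord0 k) => [j ->|->].
  by rewrite lift_perm_lift !tnthS tnth_mktuple.
by rewrite lift_perm_id !tnth0.
Qed.

Lemma slice_swap (R : realType) m n (T : tensor R m.+2 n) i j :
  symmetric_tensor T -> slice (slice T i) j = slice (slice T j) i.
Proof.
move=> symT; apply/funext => t; rewrite /slice.
rewrite -[RHS](symT (tperm ord0 (lift ord0 ord0))); congr T.
apply: eq_from_tnth => k; rewrite tnth_mktuple.
(* k runs through the positions 0, 1 and those at least 2. *)
case: (unliftP ord0 k) => [k' ->|->]; last first.
  by rewrite tpermL tnthS !tnth0.
case: (unliftP ord0 k') => [l ->|->]; last by rewrite tpermR tnthS !tnth0.
by rewrite tpermD// !tnthS.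
Qed.

(** * Uniform first-order Taylor expansion on the unit ball *)

(** [dF x v] stands for the derivative of F at x in the direction v. The single
    constant M bounds F, its derivative and the quadratic remainder over the
    whole unit ball; including the first two makes the class stable under
    products. *)
Definition has_taylor (R : realType) n (F : 'cV[R]_n -> R)
    (dF : 'cV[R]_n -> 'cV[R]_n -> R) : Prop :=
  exists2 M : R, 0 <= M & forall x y, norm2 x <= 1 -> norm2 y <= 1 ->
    [/\ `|F x| <= M, forall v, `|dF x v| <= M * norm2 v &
        `|F y - F x - dF x (y - x)| <= M * norm2 (y - x) ^+ 2].

Lemma has_taylor_cst (R : realType) n (c : R) :
  has_taylor (fun _ : 'cV[R]_n => c) (fun _ _ => 0).
Proof.
exists `|c| => // x y _ _; split=> // [v|].
  by rewrite normr0 mulr_ge0 ?norm2_ge0.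
by rewrite subrr subr0 normr0 mulr_ge0 ?sqr_ge0.
Qed.

Lemma has_taylor_coord (R : realType) n i :
  has_taylor (fun x : 'cV[R]_n => x i 0) (fun _ v => v i 0).
Proof.
exists 1 => // x y x1 _; split=> [|v|]; first exact: le_trans (coord_norm2 _ _) x1.
  by rewrite mul1r coord_norm2.
by rewrite !mxE subrr normr0 mul1r sqr_ge0.
Qed.

Lemma has_taylorD (R : realType) n (F G : 'cV[R]_n -> R) dF dG :
  has_taylor F dF -> has_taylor G dG ->
  has_taylor (fun x => F x + G x) (fun x v => dF x v + dG x v).
Proof.
move=> [M M0 FM] [N N0 GN]; exists (M + N); first exact: addr_ge0.
move=> x y x1 y1; have [Fx dFx RF] := FM x y x1 y1.
have [Gx dGx RG] := GN x y x1 y1; split=> [|v|].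
- by rewrite (le_trans (ler_normD _ _))// lerD.
- by rewrite (le_trans (ler_normD _ _))// mulrDl lerD.
- rewrite (_ : F y + G y - (F x + G x) - (dF x (y - x) + dG x (y - x)) =
    (F y - F x - dF x (y - x)) + (G y - G x - dG x (y - x))); last by ring.
  by rewrite (le_trans (ler_normD _ _))// mulrDl lerD.
Qed.

(** Points of the unit ball are at distance at most 2, so the quadratic
    remainder is at most 2 M |y - x|; the linear part contributes M |y - x|. *)
Lemma has_taylor_lipschitz (R : realType) n (F : 'cV[R]_n -> R) dF :
  has_taylor F dF -> exists2 L : R, 0 <= L & forall x y,
    norm2 x <= 1 -> norm2 y <= 1 -> `|F y - F x| <= L * norm2 (y - x).
Proof.
move=> [M M0 FM]; exists (3 * M) => [|x y x1 y1]; first by rewrite mulr_ge0.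
have [_ /(_ (y - x)) dFx RF] := FM x y x1 y1.
have yx2 : norm2 (y - x) <= 2.
  rewrite (le_trans (norm2D _ _))// norm2N; lra.
have d0 := norm2_ge0 (y - x).
have dd : M * norm2 (y - x) ^+ 2 <= 2 * (M * norm2 (y - x)).
  by rewrite expr2 mulrA [leLHS]mulrC ler_wpM2r// mulr_ge0.
have := ler_normD (F y - F x - dF x (y - x)) (dF x (y - x)).
rewrite subrK; lra.
Qed.

Lemma has_taylorM (R : realType) n (F G : 'cV[R]_n -> R) dF dG :
  has_taylor F dF -> has_taylor G dG ->
  has_taylor (fun x => F x * G x) (fun x v => F x * dG x v + G x * dF x v).
Proof.
move=> hF hG; have [L L0 FL] := has_taylor_lipschitz hF.
case: hF hG => [M M0 FM] [N N0 GN].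
exists (2 * (M * N) + L * N); first by rewrite addr_ge0 ?mulr_ge0.
have MN0 : 0 <= M * N by rewrite mulr_ge0.
have LN0 : 0 <= L * N by rewrite mulr_ge0.
move=> x y x1 y1; have [Fx dFx RF] := FM x y x1 y1.
have [Fy _ _] := FM y y y1 y1.
have [Gx dGx RG] := GN x y x1 y1; split=> [|v|].
- have := ler_pM (normr_ge0 _) (normr_ge0 _) Fx Gx; rewrite -normrM; lra.
- rewrite (le_trans (ler_normD _ _))// !normrM.
  have := ler_pM (normr_ge0 _) (normr_ge0 _) Fx (dGx v).
  have := ler_pM (normr_ge0 _) (normr_ge0 _) Gx (dFx v).
  have := mulr_ge0 LN0 (norm2_ge0 v); lra.
- set d := norm2 (y - x) in RF RG *.
  rewrite (_ : F y * G y - F x * G x -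
      (F x * dG x (y - x) + G x * dF x (y - x)) =
    F y * (G y - G x - dG x (y - x)) + G x * (F y - F x - dF x (y - x))
    + (F y - F x) * dG x (y - x)); last by ring.
  rewrite (le_trans (ler_normD _ _))//.
  rewrite (le_trans (lerD (ler_normD _ _) (lexx _)))// !normrM.
  have := ler_pM (normr_ge0 _) (normr_ge0 _) Fy RG.
  have := ler_pM (normr_ge0 _) (normr_ge0 _) Gx RF.
  have := ler_pM (normr_ge0 _) (normr_ge0 _) (FL x y x1 y1) (dGx (y - x)).
  rewrite -/d expr2; lra.
Qed.

Lemma has_taylor_ext (R : realType) n (F G : 'cV[R]_n -> R) dF dG :
  has_taylor F dF -> (forall x, F x = G x) -> (forall x v, dF x v = dG x v) ->
  has_taylor G dG.
Proof.
move=> hF /funext <- dFG; suff <- : dF = dG by [].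
by apply/funext => x; apply/funext => v.
Qed.

Lemma has_taylor_sum (R : realType) n (I : finType) (F : I -> 'cV[R]_n -> R) dF :
  (forall i, has_taylor (F i) (dF i)) ->
  has_taylor (fun x => \sum_i F i x) (fun x v => \sum_i dF i x v).
Proof.
move=> hF; elim: (index_enum I) => [|i r IHr].
  by apply: has_taylor_ext (has_taylor_cst n 0) _ _ => *; rewrite big_nil.
by apply: has_taylor_ext (has_taylorD (hF i) IHr) _ _ => *; rewrite big_cons.
Qed.

(** The derivative is computed by induction on the order from
    T(x, ..., x) = sum_i x_i T_i(x, ..., x), where T_i is the slice at i. The
    product rule gives <T(I, x, ..., x), v> plus the sum of the x_i times the
    derivatives of the T_i. By the induction hypothesis the latter only involve
    the double slices T_ij, and exchanging i and j by symmetry of T folds the sum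
    back to (order - 1) copies of <T(I, x, ..., x), v>. *)
Lemma mu_has_taylor (R : realType) m n (T : tensor R m.+1 n) :
  symmetric_tensor T ->
  has_taylor (mu T) (fun x v => m.+1%:R * dot (contractI T x) v).
Proof.
elim: m T => [|m IHm] T symT.
  have muS x i : mu (slice T i) x = slice T i [tuple].
    rewrite /mu (big_pred1 [tuple]) => [|t]; last by rewrite [t]tuple0; apply/esym/eqP.
    by rewrite big_ord0 mulr1.
  have := has_taylor_sum (fun i => has_taylorM (has_taylor_coord R i)
    (has_taylor_cst n (slice T i [tuple]))).
  move=> h; apply: has_taylor_ext h _ _ => [x|x v].
    by rewrite mu_slice; apply: eq_bigr => i _; rewrite muS.
  rewrite mul1r dotE; apply: eq_bigr => i _.
  by rewrite mulr0 add0r mxE muS.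
have := has_taylor_sum (fun i => has_taylorM (has_taylor_coord R i)
    (IHm (slice T i) (slice_symmetric i symT))).
move=> h; apply: has_taylor_ext h _ _ => [x|x v]; first by rewrite mu_slice.
rewrite big_split/= [m.+2%:R]mulrSr mulrDl mul1r; congr (_ + _); last first.
  by rewrite dotE; apply: eq_bigr => i _; rewrite mxE.
under eq_bigr do rewrite mulrCA dotE.
rewrite -mulr_sumr; congr (_ * _).
under eq_bigr do rewrite mulr_sumr.
rewrite exchange_big/= dotE; apply: eq_bigr => j _.
rewrite !mxE mu_slice mulr_suml; apply: eq_bigr => i _.
by rewrite mxE (slice_swap i j symT) mulrA.
Qed.

(** * The Jacobian of gvec *)

(** The Taylor constants are obtained entry by entry; this merges them into one. *)
Lemma common_bound (R : realType) (I : finType) (P : I -> R -> Prop) :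
  (forall i a b, a <= b -> P i a -> P i b) ->
  (forall i, exists2 M : R, 0 <= M & P i M) ->
  exists2 M : R, 0 <= M & forall i, P i M.
Proof.
move=> monoP exM.
have [M hM] := choice (fun i => let: ex_intro2 M M0 PM := exM i in
  ex_intro (fun M => 0 <= M /\ P i M) M (conj M0 PM)).
have M0 i : 0 <= M i by case: (hM i).
exists (\sum_i M i) => [|i]; first exact: sumr_ge0.
apply: monoP (proj2 (hM i)).
by rewrite (bigD1 i)//= lerDl sumr_ge0.
Qed.

Lemma Amat_mulE (R : realType) m n (T : tensor R m.+2 n) x v i :
  (Amat T x *m v) i 0 =
  m.+1%:R * dot (contractI (slice T i) x) v -
    (mu T x * v i 0 + x i 0 * (m.+2%:R * dot (contractI T x) v)).
Proof.
rewrite /Amat /Hmat !mulmxBl -!scalemxAl mul_scalar_mx -mulmxA.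
rewrite [_^T *m v]mx11_scalar mul_mx_scalar -/(dot _ _).
have contractIIv : (contractII T x *m v) i 0 = dot (contractI (slice T i) x) v.
  by rewrite mxE dotE; apply: eq_bigr => j _; rewrite !mxE.
move: (contractII T x *m v) contractIIv (dot (contractI T x) v) => w wi d.
by rewrite !mxE wi opprD addrA [in RHS]mulrCA (mulrC (x i 0)).
Qed.

(** The product rule applied to T(I, x, ..., x) - mu(x) x yields [Amat T x] as
    the Jacobian; the rank-one term comes from differentiating mu. *)
Lemma gvec_has_taylor (R : realType) m n (T : tensor R m.+2 n) i :
  symmetric_tensor T ->
  has_taylor (fun x => gvec T x i 0) (fun x v => (Amat T x *m v) i 0).
Proof.
move=> symT.
have := has_taylorD (mu_has_taylor (slice_symmetric i symT))
  (has_taylorM (has_taylor_cst n (-1))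
    (has_taylorM (mu_has_taylor symT) (has_taylor_coord R i))).
move=> h; apply: has_taylor_ext h _ _ => [x|x v].
  by rewrite !mxE mulN1r.
by rewrite Amat_mulE mulr0 addr0 mulN1r.
Qed.

Lemma Amat_has_taylor (R : realType) m n (T : tensor R m.+2 n) i j :
  symmetric_tensor T -> exists dF, has_taylor (fun x => Amat T x i j) dF.
Proof.
move=> symT.
have hII : exists dF, has_taylor (mu (slice (slice T i) j)) dF.
  (* For a tensor of order 2 the double slice has order 0, hence is constant. *)
  case: m T symT => [|m] T symT; last first.
    by eexists; apply: mu_has_taylor; do 2!apply: slice_symmetric.
  eexists; apply: has_taylor_ext (has_taylor_cst n (mu (slice (slice T i) j) 0)) _ _.
    by move=> x; rewrite /mu; apply: eq_bigr => t _; rewrite !big_ord0.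
  by [].
case: hII => dF hII.
have hxI := has_taylorM (has_taylor_coord R i)
  (mu_has_taylor (slice_symmetric j symT)).
have h := has_taylorD (has_taylorM (has_taylor_cst n m.+1%:R) hII)
  (has_taylorD (has_taylorM (has_taylor_cst n (- (i == j)%:R)) (mu_has_taylor symT))
   (has_taylorM (has_taylor_cst n (- m.+2%:R)) hxI)).
eexists; apply: has_taylor_ext h _ (fun _ _ => erefl) => x.
rewrite !mxE big_ord_recl big_ord0 !mxE addr0 mulNr -addrA mulNr.
by rewrite (mulr_natl (mu T x)). 
Qed.

Lemma newton_remainder (R : realType) m n (T : tensor R m.+2 n) :
  symmetric_tensor T -> exists2 M : R, 0 <= M & forall x y,
    norm2 x <= 1 -> norm2 y <= 1 ->
    norm2 (gvec T y - gvec T x - Amat T x *m (y - x)) <= M * norm2 (y - x) ^+ 2.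
Proof.
move=> symT.
have [|i|M M0 gM] := @common_bound R 'I_n (fun i M => forall x y,
    norm2 x <= 1 -> norm2 y <= 1 ->
    `|(gvec T y - gvec T x - Amat T x *m (y - x)) i 0| <=
      M * norm2 (y - x) ^+ 2).
- move=> i a b ab ha x y x1 y1; apply: le_trans (ha x y x1 y1) _.
  by rewrite ler_wpM2r ?sqr_ge0.
- have [M M0 gM] := gvec_has_taylor i symT; exists M => // x y x1 y1.
  by case: (gM x y x1 y1) => _ _; rewrite !mxE.
exists (n%:R * M) => [|x y x1 y1]; first by rewrite mulr_ge0.
by rewrite -mulrA; apply: norm2_bound => i; exact: gM.
Qed.

Lemma Amat_lipschitz (R : realType) m n (T : tensor R m.+2 n) :
  symmetric_tensor T -> exists2 L : R, 0 <= L & forall x y v,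
    norm2 x <= 1 -> norm2 y <= 1 ->
    norm2 ((Amat T y - Amat T x) *m v) <= L * norm2 (y - x) * norm2 v.
Proof.
move=> symT.
have [|[i j]|L L0 AL] := @common_bound R ('I_n * 'I_n)%type
    (fun p L => forall x y, norm2 x <= 1 -> norm2 y <= 1 ->
      `|Amat T y p.1 p.2 - Amat T x p.1 p.2| <= L * norm2 (y - x)).
- move=> i a b ab ha x y x1 y1; apply: le_trans (ha x y x1 y1) _.
  by rewrite ler_wpM2r ?norm2_ge0.
- by have [dF /has_taylor_lipschitz] := Amat_has_taylor i j symT.
exists (n%:R * n%:R * L) => [|x y v x1 y1]; first by rewrite !mulr_ge0.
rewrite -(mulrA _ L); apply: mulmx_norm2_bound => i j.
by have := AL (i, j) x y x1 y1; rewrite !mxE.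
Qed.

(** * The Jacobian at a Newton-stable eigenpair *)

Lemma contractII_sym (R : realType) m n (T : tensor R m.+2 n) x :
  symmetric_tensor T -> (contractII T x)^T = contractII T x.
Proof.
by move=> symT; apply/matrixP => i j; rewrite !mxE (slice_swap _ _ symT).
Qed.

Lemma mu_dot (R : realType) m n (T : tensor R m.+1 n) x :
  mu T x = dot x (contractI T x).
Proof. by rewrite mu_slice dotE; apply: eq_bigr => i _; rewrite mxE. Qed.

Lemma contractII_mul (R : realType) m n (T : tensor R m.+2 n) x :
  contractII T x *m x = contractI T x.
Proof.
apply/colP => i; rewrite !mxE mu_slice; apply: eq_bigr => j _.
by rewrite !mxE mulrC.
Qed.

Lemma eigenpair_mu (R : realType) m n (T : tensor R m.+1 n) x lambda :
  eigenpair T x lambda -> mu T x = lambda.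
Proof.
by case=> Tx x1; rewrite mu_dot Tx dotZr -norm2_sqr x1 expr1n mulr1.
Qed.

Lemma gvec_eigenpair (R : realType) m n (T : tensor R m.+1 n) x lambda :
  eigenpair T x lambda -> gvec T x = 0.
Proof. by move=> e; rewrite /gvec (eigenpair_mu e) (proj1 e) subrr. Qed.

Lemma Amat_eigenpair (R : realType) m n (T : tensor R m.+2 n) x lambda :
  eigenpair T x lambda ->
  Amat T x = Hmat T x - (m.+2%:R * lambda) *: (x *m x^T).
Proof.
by case=> Tx _; rewrite /Amat Tx [(_ *: x)^T]linearZ/= -scalemxAr scalerA.
Qed.

Lemma Amat_eigenpair_sym (R : realType) m n (T : tensor R m.+2 n) x lambda :
  symmetric_tensor T -> eigenpair T x lambda -> (Amat T x)^T = Amat T x.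
Proof.
move=> symT /Amat_eigenpair ->; rewrite /Hmat !linearB/= !linearZ/=.
by rewrite trmx_mul trmxK tr_scalar_mx contractII_sym.
Qed.

(** With d the order of T, H xs = ((d - 1) lambda - lambda) xs, and the rank-one
    term of A contributes - d lambda xs. *)
Lemma Amat_mul_eigenvector (R : realType) m n (T : tensor R m.+2 n) x lambda :
  eigenpair T x lambda -> Amat T x *m x = (- (2 * lambda)) *: x.
Proof.
move=> e; have [Tx x1] := e.
rewrite (Amat_eigenpair e) /Hmat !mulmxBl -!scalemxAl contractII_mul Tx.
rewrite mul_scalar_mx (eigenpair_mu e) -mulmxA [x^T *m x]mx11_scalar.
rewrite mul_mx_scalar -/(dot x x) -norm2_sqr x1 expr1n scale1r.
rewrite scalerA -!scalerBl; congr (_ *: _).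
by rewrite (mulrSr _ m.+1) mulrSr; ring.
Qed.

(** Since [Amat T x] x = -2 lambda x, a row eigenvector v with eigenvalue a
    satisfies a (v x) = -2 lambda (v x). Either a = -2 lambda, or v is orthogonal
    to x; then v = w U^T, and w is an eigenvector of the projected Hessian for the
    same eigenvalue, because the rank-one term of [Amat T x] vanishes on v. *)
Lemma Amat_eigenvalue_bound (R : realType) m n (T : tensor R m.+2 n) gamma x
    lambda a :
  symmetric_tensor T -> eigenpair T x lambda -> newton_stable T gamma x ->
  eigenvalue (Amat T x) a -> Num.min gamma (2 * `|lambda|) <= `|a|.
Proof.
move=> symT e [U [UU /eqmxP Ux] stable] /eigenvalueP [v vA v0].
rewrite ge_min; have [vx0|vx0] := eqVneq (v *m x) 0; last first.
  apply/orP; right; suff -> : a = - (2 * lambda).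
    by rewrite normrN normrM ger0_norm.
  apply/eqP; rewrite -subr_eq0; apply/eqP.
  have /eqP : (a - - (2 * lambda)) *: (v *m x) = 0.
    by rewrite scalerBl scalemxAl -vA -mulmxA (Amat_mul_eigenvector e) scalemxAr subrr.
  by rewrite scaler_eq0 (negbTE vx0) orbF => /eqP.
apply/orP; left; apply: stable; apply/eigenvalueP.
have /submxP [w vw] : (v <= U^T)%MS by rewrite Ux; apply/sub_kermxP.
exists w; last by apply: contra_neq v0 => w0; rewrite vw w0 mul0mx.
have xU : x^T *m U = 0.
  have : (U^T <= kermx x)%MS by rewrite Ux.
  by move/sub_kermxP/(congr1 trmx); rewrite trmx_mul trmxK trmx0.
rewrite /Hproj !mulmxA -vw (_ : v *m Hmat T x = a *: v); last first.
  rewrite -vA (Amat_eigenpair e) [RHS]mulmxBr -scalemxAr mulmxA vx0 mul0mx.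
  by rewrite scaler0 subr0.
by rewrite vw -scalemxAl -mulmxA UU mulmx1.
Qed.

Lemma Amat_eigenpair_bound (R : realType) m n (T : tensor R m.+2 n) gamma x
    lambda :
  symmetric_tensor T -> eigenpair T x lambda -> newton_stable T gamma x ->
  forall v, Num.min gamma (2 * `|lambda|) * norm2 v <= norm2 (Amat T x *m v).
Proof.
move=> symT e st; apply: symmetric_eigenvalue_bound.
  exact: Amat_eigenpair_sym e.
by move=> a; exact: Amat_eigenvalue_bound.
Qed.

(** * One step of the method *)

Lemma unitmx_norm2 (R : realType) n (A : 'M[R]_n) (d : R) :
  0 < d -> (forall v, d * norm2 v <= norm2 (A *m v)) -> A \in unitmx.
Proof.
move=> d0 Ad; rewrite -unitmx_tr unitmxE unitfE.
apply/negP => /det0P [v v0 vA].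
have := Ad v^T; rewrite -[A]trmxK -trmx_mul vA trmx0 norm20.
rewrite pmulr_rle0// => v_le0; move/eqP: v0; apply.
apply: trmx_inj; rewrite trmx0; apply: norm2_eq0; apply/eqP.
by rewrite eq_le v_le0 norm2_ge0.
Qed.

(** The normalized vector differs from z by | |z| - 1 | = | |z| - |e| |, which
    is at most |z - e|. The bound also holds for z = 0, where the left side is 1. *)
Lemma normalize_dist (R : realType) n (z e : 'cV[R]_n) :
  norm2 e = 1 -> norm2 ((norm2 z)^-1 *: z - e) <= 2 * norm2 (z - e).
Proof.
move=> e1; have [z0|z0] := eqVneq (norm2 z) 0.
  rewrite (norm2_eq0 z0) scaler0 !sub0r norm2N e1; lra.
have -> : (norm2 z)^-1 *: z - e = ((norm2 z)^-1 - 1) *: z + (z - e).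
  by rewrite scalerBl scale1r addrA subrK.
rewrite (le_trans (norm2D _ _))// mulr_natl mulr2n lerD2r norm2Z.
rewrite -{2}(ger0_norm (norm2_ge0 z)) -normrM mulrBl mulVf// mul1r.
have h1 := norm2B z e; have h2 := norm2B e z.
rewrite norm2_distC in h2; rewrite e1 in h1 h2.
rewrite ler_norml; lra.
Qed.

(** The Newton identity: the new error, multiplied by the Jacobian at x, is the
    Taylor remainder of [gvec T] at x evaluated at the zero xs. *)
Lemma newton_step_bound (R : realType) m n (T : tensor R m.+2 n) xs x (d M : R) :
  0 < d -> gvec T xs = 0 ->
  (forall v, d * norm2 v <= norm2 (Amat T x *m v)) ->
  norm2 (gvec T xs - gvec T x - Amat T x *m (xs - x)) <=
    M * norm2 (xs - x) ^+ 2 ->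
  d * norm2 (x + ncm_correction T x - xs) <= M * norm2 (x - xs) ^+ 2.
Proof.
move=> d0 gxs Ad; rewrite (norm2_distC xs) gxs sub0r; apply: le_trans.
apply: le_trans (Ad _) _; rewrite le_eqVlt; apply/orP; left; apply/eqP.
have uA := unitmx_norm2 d0 Ad; congr norm2.
rewrite addrAC mulmxDr /ncm_correction mulmxN mulKVmx//.
by rewrite -(opprB x) mulmxN opprK [RHS]addrC.
Qed.

Lemma ncm_step_quadratic (R : realType) m n (T : tensor R m.+2 n)
    (gamma lambda : R) :
  symmetric_tensor T -> 0 < gamma -> lambda != 0 ->
  exists2 eps : R, 0 < eps & exists2 C : R, 0 < C & C * eps <= 2^-1 /\
    forall xs, eigenpair T xs lambda -> newton_stable T gamma xs ->
    forall x, sphere x -> norm2 (x - xs) < eps ->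
      [/\ Amat T x \in unitmx, x + ncm_correction T x != 0 &
          norm2 (ncm_step T x - xs) <= C * norm2 (x - xs) ^+ 2].
Proof.
move=> symT gamma0 lambda0; set d := Num.min gamma (2 * `|lambda|).
have d0 : 0 < d by rewrite lt_min gamma0 mulr_gt0 ?normr_gt0.
have [M M0 remM] := newton_remainder symT.
have [L L0 lipL] := Amat_lipschitz symT.
have Md0 : 0 <= M / d by rewrite divr_ge0 // ltW.
have Ld0 : 0 <= L / d by rewrite divr_ge0 // ltW.
(* Newton with lower bound d / 2 contributes 2 M / d, and normalization a factor
   2. The extra 1 makes C >= 1, so that eps < 1. *)
pose C := 4 * (M / d) + 1.
have CL0 : 0 < C + L / d by rewrite /C; lra.
(* Ensures both C eps <= 1/2 and L eps <= d / 2. *)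
pose eps := (2 * (C + L / d))^-1.
have eps0 : 0 < eps by rewrite invr_gt0 mulr_gt0.
have Ceps : C * eps + L / d * eps = 2^-1.
  by rewrite -mulrDl /eps invfM mulrCA mulfV ?mulr1 ?gt_eqF.
have Leps : 0 <= L / d * eps by rewrite mulr_ge0// ltW.
exists eps => //; exists C; first by rewrite /C; lra.
split=> [|xs e st x /= x1 xxs]; first by lra.
have [_ xs1] := e; set r := norm2 (x - xs) in xxs *.
have r0 : 0 <= r := norm2_ge0 _.
(* The lower bound d at xs loses at most L r <= d / 2 when moving to x. *)
have Ad v : d / 2 * norm2 v <= norm2 (Amat T x *m v).
  have := Amat_eigenpair_bound symT e st v; rewrite -/d => Axs.
  have := lipL x xs v; rewrite x1 xs1 => /(_ (lexx _) (lexx _)).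
  rewrite norm2_distC -/r mulmxBl => lipA.
  have := norm2B (Amat T xs *m v) (Amat T xs *m v - Amat T x *m v).
  rewrite subKr => triangle.
  have Lr : L * r <= d / 2.
    rewrite -ler_pdivrMl// mulrA [d^-1 * _]mulrC (le_trans (ler_wpM2l Ld0 (ltW xxs)))//.
    have : 0 <= C * eps by rewrite mulr_ge0 /C ?ltW//; lra.
    lra.
  have := ler_wpM2r (norm2_ge0 v) Lr; lra.
have d20 : 0 < d / 2 by lra.
have := newton_step_bound d20 (gvec_eigenpair e) Ad
  (remM x xs _ _); rewrite x1 xs1 => /(_ (lexx _) (lexx _)).
rewrite -/r -ler_pdivlMl// => step.
have {}step : 2 * norm2 (x + ncm_correction T x - xs) <= C * r ^+ 2.
  rewrite -ler_pdivlMl//; apply: le_trans step _.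
  rewrite /C [leLHS](_ : _ = 2 * (M / d) * r ^+ 2); last by field; rewrite gt_eqF.
  have := sqr_ge0 r; lra.
split; first exact: unitmx_norm2 d20 Ad.
  (* If the unnormalized iterate were 0, its distance to xs would be 1, whereas
     the bound gives at most C r ^ 2 / 2 < 1. *)
  apply: contraTneq step => ->; rewrite sub0r norm2N xs1 mulr1 -ltNge.
  have C0 : 1 <= C by rewrite /C; lra.
  have Ce : eps <= C * eps by rewrite ler_peMl // ltW.
  have eps1 : eps <= 1 by lra.
  have r1 : r ^+ 2 <= r by rewrite expr2 ler_piMr//; lra.
  have := ler_wpM2l (le_trans ler01 C0) (le_trans r1 (ltW xxs)); lra.
exact: le_trans (normalize_dist _ xs1) step.
Qed.

(** * Convergence of the iterates *)

Lemma ncm_step_sphere (R : realType) m n (T : tensor R m.+2 n) x :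
  x + ncm_correction T x != 0 -> sphere (ncm_step T x).
Proof.
move=> z0; rewrite /sphere /= /ncm_step norm2Z ger0_norm ?invr_ge0 ?norm2_ge0//.
by rewrite mulVf//; apply: contra_neq z0; exact: norm2_eq0.
Qed.

Lemma cvg_norm2_geometric (R : realType) n (x : nat -> 'cV[R]_n) xs (r : R) :
  (forall k, norm2 (x k - xs) <= r * 2^-1 ^+ k) -> x @ \oo --> xs.
Proof.
move=> xr; apply/subr_cvg0/norm_cvg0P.
apply: (@squeeze_cvgr _ _ _ _ (fun=> 0) (fun k => r * 2^-1 ^+ k)).
- by near=> k; rewrite normr_ge0 (le_trans (mx_norm_le_norm2 _)).
- exact: cvg_cst.
- by apply: cvg_geometric; rewrite ger0_norm; lra.
Unshelve. all: by end_near. Qed.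

Theorem theorem1 (R : realType) (m n : nat) (T : tensor R m.+2 n)
    (symT : symmetric_tensor T) (gamma lambda : R)
    (gamma_gt0 : 0 < gamma) (lambda_neq0 : lambda != 0) :
  exists2 eps : R, 0 < eps &
    forall xs : 'cV[R]_n,
      eigenpair T xs lambda -> newton_stable T gamma xs ->
      forall x0 : 'cV[R]_n, sphere x0 -> norm2 (x0 - xs) < eps ->
        ncm_well_defined T x0 /\ converges_quadratically (ncm T x0) xs.
Proof.
have [eps eps0 [C C0 [Ceps stepP]]] :=
  ncm_step_quadratic symT gamma_gt0 lambda_neq0.
exists eps => // xs e st x0 x01 x0xs.
have {}stepP := stepP xs e st.
set r := norm2 (x0 - xs) in x0xs.
have inv k : [/\ sphere (ncm T x0 k), norm2 (ncm T x0 k - xs) < eps &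
    norm2 (ncm T x0 k - xs) <= r * 2^-1 ^+ k].
  elim: k => [|k [sk epsk rk]]; first by split; rewrite ?expr0 ?mulr1.
  have [_ nz quad] := stepP _ sk epsk; set rho := norm2 (ncm T x0 k - xs) in epsk rk quad.
  have rho0 : 0 <= rho := norm2_ge0 _.
  have half : norm2 (ncm T x0 k.+1 - xs) <= 2^-1 * rho.
    apply: le_trans quad _; rewrite expr2 mulrA ler_wpM2r//.
    by apply: le_trans Ceps; rewrite ler_wpM2l// ltW.
  split; first exact: ncm_step_sphere.
    by apply: le_lt_trans half _; lra.
  by apply: le_trans half _; rewrite exprS mulrCA ler_wpM2l.
have xk_step k := let: And3 sk epsk _ := inv k in stepP _ sk epsk.
split=> [k|]; first by have [] := xk_step k.
split.
  by apply: (@cvg_norm2_geometric _ _ _ _ r) => k; have [] := inv k.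
exists C => // k; rewrite norm2_distC (norm2_distC xs).
by have [] := xk_step k.
Qed.
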